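(* Consider the two-block problem $$\min_{y\in\mathbb Y,z\in\mathbb Z}\{p(y)-\langle b,z\rangle\mid\mathcal F^*y+\mathcal G^*z=c\}$$ and assume that its KKT system has a nonempty solution set $\mathbf K\subset\mathbb X\times\mathbb Y\times\mathbb Z$. Let $\sigma>0$, $\tau\in(0,2)$, and let $\{(x^k,y^k,z^k)\}$ be a sequence generated by the classic two-block ADMM or its inexact variant (described in the context), in which the $y$-subproblem is solved before the $z$-subproblem. If either $\mathcal F$ is surjective or $p$ is strongly convex, then the sequence $\{(x^k,y^k,\Pi_{\operatorname{Range}(\mathcal G)}(z^k))\}$ converges to a point in $\mathbf K$. Moreover, if $\mathcal G$ is also surjective, then the sequence $\{(x^k,y^k,z^k)\}$ converges to a point in $\mathbf K$.
   Context: $\mathbb X,\mathbb Y,\mathbb Z$ are finite-dimensional real Hilbert spaces, $p:\mathbb Y\to(-\infty,+\infty]$ is closed proper convex, $\mathcal F:\mathbb X\to\mathbb Y$ and $\mathcal G:\mathbb X\to\mathbb Z$ are linear with adjoints $\mathcal F^*,\mathcal G^*$, $b\in\mathbb Z$, $c\in\mathbb X$. $\Pi_H$ is the metric projection onto $H$. KKT system: $0\in\partial p(y)+\mathcal Fx$, $\ \mathcal Gx-b=0$, $\ \mathcal F^*y+\mathcal G^*z=c$. Augmented Lagrangian: $L_\sigma(y,z;x):=p(y)-\langle b,z\rangle+\langle x,\mathcal F^*y+\mathcal G^*z-c\rangle+\tfrac\sigma2\|\mathcal F^*y+\mathcal G^*z-c\|^2$. (Inexact) two-block ADMM: let $\{\tilde\varepsilon_k\}$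 be a summable sequence of nonnegative numbers and $(x^0,y^0,z^0)\in\mathbb X\times\operatorname{dom}p\times\mathbb Z$. For $k=0,1,\dots$: (1) compute $y^{k+1}\approx\operatorname{argmin}_yL_\sigma(y,z^k;x^k)$ such that there is $\delta^k\in\partial_yL_\sigma(y^{k+1},z^k;x^k)$ with $\|\delta^k\|\le\tilde\varepsilon_k$; (2) compute $z^{k+1}\approx\operatorname{argmin}_zL_\sigma(y^{k+1},z;x^k)$ such that $\|\nabla_zL_\sigma(y^{k+1},z^{k+1};x^k)\|\le\tilde\varepsilon_k$; (3) $x^{k+1}:=x^k+\tau\sigma(\mathcal F^*y^{k+1}+\mathcal G^*z^{k+1}-c)$. The classic ADMM is the case in which all subproblems are solved exactly ($\tilde\varepsilon_k\equiv0$). *)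

(* Defs.v *)
From HB Require Import structures.
From mathcomp Require Import all_boot all_order all_algebra.
From mathcomp Require Import sesquilinear.
From mathcomp Require Import all_classical all_reals all_analysis.

Set Implicit Arguments.
Unset Strict Implicit.
Unset Printing Implicit Defensive.

Import Order.TTheory GRing.Theory Num.Theory.
Import numFieldNormedType.Exports.

Local Open Scope classical_set_scope.
Local Open Scope ring_scope.

(* Finite-dimensional real Hilbert spaces: the norm, hence the topology, is the
   one induced by the inner product; completeness follows from finite
   dimension. *)
HB.mixin Record NormedModule_isInner (R : realType) V of NormedModule R V := {
  inner : {dot V for idfun};
  inner_norm : forall u : V, inner u u = `|u| ^+ 2
}.

#[short(type="finHilbertType")]
HB.structure Definition FinHilbert (R : realType) :=
  {V of NormedModule_isInner R V & NormedModule R V & Vector R V}.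

Notation "''<' u , v >" := (inner u v)
  (at level 2, u at level 69, v at level 69, format "''<' u ,  v >") :
  ring_scope.

Definition is_adjoint (R : realType) (U V : finHilbertType R)
    (A : {linear U -> V}) (As : {linear V -> U}) : Prop :=
  forall u v, '<A u, v> = '<u, As v>.

(* When A is a nonempty closed convex set, the nearest point exists and is
   unique; otherwise the value may be the dummy 0. *)
Definition metric_proj (R : realType) (V : finHilbertType R) (A : set V)
    (v : V) : V :=
  xget 0 [set a | A a /\ forall a', A a' -> `|v - a| <= `|v - a'|].

Section ConvexFunctions.
Context (R : realType) (V : finHilbertType R).
Implicit Types f : V -> \bar R.

Definition proper f : Prop := (forall u, f u != -oo%E) /\ exists u, f u != +oo%E.

(* At t = 0 and t = 1 the convention 0 * +oo = 0 applies. *)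
Definition convex_efun f : Prop :=
  forall (u v : V) (t : R), 0 <= t <= 1 ->
    (f (t *: u + (1 - t) *: v)%R <= t%:E * f u + (1 - t)%:E * f v)%E.

Definition closed_proper_convex f : Prop :=
  [/\ lower_semicontinuous f, proper f & convex_efun f].

Definition strongly_convex f : Prop :=
  exists2 mu : R, 0 < mu & forall (u v : V) (t : R), 0 <= t <= 1 ->
    (f (t *: u + (1 - t) *: v)%R <=
     t%:E * f u + (1 - t)%:E * f v
     - (mu / 2 * t * (1 - t) * `|u - v| ^+ 2)%:E)%E.

Definition edom f : set V := [set u | f u < +oo]%E.

(* If f is proper, this is empty outside of the domain of f. *)
Definition subdiff f (u : V) : set V :=
  [set g | forall v, f u + ('<g, v - u>)%:E <= f v]%E.

Definition argmin f : set V := [set u | forall v, f u <= f v]%E.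

Definition is_gradient (f : V -> R) (u g : V) : Prop :=
  differentiable f u /\ forall h, 'd f u h = '<g, h>.

End ConvexFunctions.

Section TwoBlock.
Context (R : realType) (X Y Z : finHilbertType R).
Context (p : Y -> \bar R) (F : {linear X -> Y}) (G : {linear X -> Z}).
Context (Fs : {linear Y -> X}) (Gs : {linear Z -> X}) (b : Z) (c : X).

Definition kkt : set (X * Y * Z) := [set w | let: (x, y, z) := w in
  [/\ [set g + F x | g in subdiff p y] 0, G x - b = 0 & Fs y + Gs z = c]].

Definition aug_lagrangian (sigma : R) (y : Y) (z : Z) (x : X) : \bar R :=
  (p y - ('<b, z>)%:E + ('<x, Fs y + Gs z - c>)%:E
   + (sigma / 2 * `|Fs y + Gs z - c| ^+ 2)%:E)%E.

Definition classic_admm (sigma tau : R)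
    (x : nat -> X) (y : nat -> Y) (z : nat -> Z) : Prop :=
  edom p (y 0) /\ forall k,
  [/\ argmin (fun v => aug_lagrangian sigma v (z k) (x k)) (y k.+1),
      argmin (fun w => aug_lagrangian sigma (y k.+1) w (x k)) (z k.+1) &
      x k.+1 = x k + (tau * sigma) *: (Fs (y k.+1) + Gs (z k.+1) - c)].

(* fine only serves to take the gradient in z: the y-step forces y k.+1 to lie
   in the domain of p, so that the augmented Lagrangian is finite there. *)
Definition inexact_admm (sigma tau : R) (eps : nat -> R)
    (x : nat -> X) (y : nat -> Y) (z : nat -> Z) : Prop :=
  edom p (y 0) /\ forall k,
  [/\ exists2 d,
        subdiff (fun v => aug_lagrangian sigma v (z k) (x k)) (y k.+1) d &
        `|d| <= eps k,
      exists2 g,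
        is_gradient (fun w => fine (aug_lagrangian sigma (y k.+1) w (x k)))
          (z k.+1) g &
        `|g| <= eps k &
      x k.+1 = x k + (tau * sigma) *: (Fs (y k.+1) + Gs (z k.+1) - c)].

End TwoBlock.

(* Main.v *)
Require Import Defs.
From HB Require Import structures.
From mathcomp Require Import all_boot all_order all_algebra.
From mathcomp Require Import sesquilinear.
From mathcomp Require Import ring lra zify.
From mathcomp Require Import all_classical all_reals all_analysis.

Set Implicit Arguments.
Unset Strict Implicit.
Unset Printing Implicit Defensive.

Import Order.TTheory GRing.Theory Num.Theory.
Import numFieldNormedType.Exports.

Local Open Scope classical_set_scope.
Local Open Scope ring_scope.

(** Write r_k = F* y_k + G* z_k - c and fix a KKT point (xb, yb, zb).

    The optimality condition of the z-step and the multiplier update combine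
    into G x_(k+1) - b = (1 - tau) (G x_k - b) + tau (error of the z-step).
    Since |1 - tau| < 1, the violation |G x_k - b| of the second KKT equation is
    summable ([gap_step], [eta_summable]).  This uses the linearity of the
    objective in z.

    Testing the monotonicity of the subdifferential of p at y_(k+1) and yb
    against the optimality condition of the y-step gives an energy inequality
    ([energy_step]) for
      energy k = |x_k - xb|^2 / (2 tau sigma) + sigma/2 |G* (z_k - zb)|^2,
    whose dissipation contains |r_(k+1)|^2 with the factor sigma (1 - tau/2) > 0.
    Besides the error of the y-step, its cross terms have the form <v, G* zeta>,
    and |<v, G* zeta>| <= C |G v| |G* zeta| ([inner_adjoint_bound]): they involve
    x_k - xb and r_(k+1) only through their images by G, which are summable.  So the
    energy decreases up to summable relative errors, hence converges, and the
    dissipation tends to 0 ([quasi_fejer]).  The surjectivity of F (which makes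
    F* bounded below) or the strong convexity of p controls |y_k - yb|.

    The iterates x_k, y_k, G* z_k are therefore bounded.  Along an ultrafilter
    finer than the eventual one they converge, and the limit is a KKT point since
    the residual tends to 0 and the graph of the subdifferential is closed
    ([ultra_limit_kkt]).  The energy relative to this new KKT point converges, and
    tends to 0 along the ultrafilter; hence it tends to 0, and the whole sequence
    converges ([steps_converge]).  Finally G* is bounded below on the range of G
    ([metric_proj_lipschitz]), so the convergence of G* z_k is that of the
    projection of z_k. *)

(** * Inner products *)

Section InnerProduct.
Context (R : realType) (V : finHilbertType R).
Implicit Types u v w : V.

Lemma innerC u v : '<u, v> = '<v, u>.
Proof. by rewrite hermC /= expr0 mul1r. Qed.

Lemma innerDr u v w : '<u, v + w> = '<u, v> + '<u, w>.
Proof. exact: linearDr. Qed.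

Lemma innerNr u v : '<u, - v> = - '<u, v>.
Proof. exact: linearNr. Qed.

Lemma innerZr u a v : '<u, a *: v> = a * '<u, v>.
Proof. exact: linearZr_LR. Qed.

Lemma innerDl u v w : '<u + v, w> = '<u, w> + '<v, w>.
Proof. by rewrite innerC innerDr !(innerC w). Qed.

Lemma innerNl u v : '<- u, v> = - '<u, v>.
Proof. by rewrite innerC innerNr innerC. Qed.

Lemma innerZl a u v : '<a *: u, v> = a * '<u, v>.
Proof. by rewrite innerC innerZr innerC. Qed.

Lemma inner0r u : '<u, 0> = 0.
Proof. exact: linear0r. Qed.

Lemma inner0l u : '<0, u> = 0.
Proof. by rewrite innerC inner0r. Qed.

Definition innerE := (innerDl, innerDr, innerNl, innerNr, innerZl, innerZr).

Lemma inner_suml (I : Type) (r : seq I) (P : pred I) (f : I -> V) v :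
  '<\sum_(i <- r | P i) f i, v> = \sum_(i <- r | P i) '<f i, v>.
Proof. by elim/big_rec2: _ => [|i a b _ <-]; rewrite ?inner0l ?innerDl. Qed.

Lemma normsqD u v : `|u + v| ^+ 2 = `|u| ^+ 2 + 2 * '<u, v> + `|v| ^+ 2.
Proof. by rewrite -!inner_norm !innerE (innerC v u); ring. Qed.

Lemma normsqZ a u : `|a *: u| ^+ 2 = a ^+ 2 * `|u| ^+ 2.
Proof. by rewrite -!inner_norm !innerE; ring. Qed.

Lemma inner_inj u v : (forall h, '<u, h> = '<v, h>) -> u = v.
Proof.
move=> uv; apply/eqP; rewrite -subr_eq0 -normr_eq0 -sqrf_eq0 -inner_norm.
by rewrite !innerE !uv; apply/eqP; ring.
Qed.

Lemma cauchy_schwarz u v : `|'<u, v>| <= `|u| * `|v|.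
Proof.
have [->|v0] := eqVneq v 0; first by rewrite inner0r !normr0 mulr0.
rewrite -(@ler_pXn2r _ 2) ?nnegrE ?mulr_ge0 // real_normK ?num_real //.
have v20 : 0 < `|v| ^+ 2 by rewrite exprn_gt0 // normr_gt0.
have : 0 <= `| `|v| ^+ 2 *: u - '<u, v> *: v| ^+ 2 by rewrite exprn_ge0.
rewrite -inner_norm !innerE (innerC v u) !inner_norm exprMn.
move: ('<u, v>) (`|u| ^+ 2) (`|v| ^+ 2) v20 => a U W W0 h.
by rewrite -subr_ge0 -(pmulr_rge0 _ W0);
  apply: le_trans h _; lra.
Qed.

Lemma inner_le u v : '<u, v> <= `|u| * `|v|.
Proof. exact: le_trans (ler_norm _) (cauchy_schwarz u v). Qed.

(** A basis and a dual family.  The map sending v to the sum of the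
    '<e_i, v> e_i over a basis e is injective, because '<v, T v> is a sum of squares;
    the f_i are the images of the e_i by its inverse.  The coordinates being inner
    products, they are bounded by the norm of v, and this gives the continuity of
    linear maps and the relative compactness of bounded sequences. *)
Lemma inner_frame : exists n (e f : 'I_n -> V),
  forall v, v = \sum_i '<e i, v> *: f i.
Proof.
set n := \dim (@fullv R V); set e := vbasis (@fullv R V).
pose t v := \sum_(i < n) '<e`_i, v> *: e`_i.
have t_linear : linear t.
  move=> a u v; rewrite /t scaler_sumr -big_split; apply: eq_bigr => i _ /=.
  by rewrite innerDr innerZr scalerDl scalerA.
pose T := linfun (HB.pack_for {linear V -> V} t
  (GRing.isLinear.Build _ _ _ _ t t_linear)).
have TE v : T v = t v by rewrite lfunE.
have T0 : lker T == 0%VS.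
  rewrite -subv0; apply/subvP => v; rewrite memv_ker memv0 TE => /eqP tv0.
  have ev i : '<e`_i, v> = 0.
    have : \sum_(i < n) '<e`_i, v> ^+ 2 = 0.
      have <- : '<t v, v> = \sum_(i < n) '<e`_i, v> ^+ 2.
        by rewrite inner_suml; apply: eq_bigr => j _; rewrite innerZl expr2.
      by rewrite tv0 inner0l.
    move/eqP; rewrite psumr_eq0; last by move=> j _; exact: sqr_ge0.
    have [ilt|nlei] := ltnP i n; last first.
      by rewrite nth_default ?inner0l // size_tuple.
    by move=> /allP /(_ (Ordinal ilt)); rewrite mem_index_enum sqrf_eq0 => /(_ isT)/eqP.
  rewrite -normr_eq0 -sqrf_eq0 -inner_norm {1}(coord_vbasis (memvf v)).
  by rewrite inner_suml big1 // => i _; rewrite innerZl ev mulr0.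
exists n, (fun i => e`_i), (fun i => (T^-1)%VF e`_i) => v.
rewrite -{1}(lker0_lfunK T0 v) TE linear_sum; apply: eq_bigr => i _.
by rewrite linearZ.
Qed.

End InnerProduct.

(** * Linear maps, limits and projections in finite dimension *)

Section LinearMaps.
Context (R : realType).

Lemma linear_bound (V W : finHilbertType R) (A : {linear V -> W}) :
  exists2 C, 0 <= C & forall v, `|A v| <= C * `|v|.
Proof.
have [n [e [f vE]]] := inner_frame V.
exists (\sum_i `|e i| * `|A (f i)|).
  by apply: sumr_ge0 => i _; rewrite mulr_ge0.
move=> v; rewrite {1}(vE v) linear_sum mulr_suml.
apply: le_trans (ler_norm_sum _ _ _) _; apply: ler_sum => i _.
rewrite linearZ /= normrZ mulrAC ler_wpM2r //; exact: cauchy_schwarz.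
Qed.

Lemma bound_cvg0 (T : Type) (D : set_system T) {FD : Filter D}
    (V W : normedModType R) (C : R) (f : T -> V) (g : T -> W) :
  (forall k, `|g k| <= C * `|f k|) -> f @ D --> 0 -> g @ D --> 0.
Proof.
move=> gf f0; apply: norm_cvg0.
apply: (@squeeze_cvgr _ _ _ _ (fun=> 0) (fun k => C * `|f k|)).
- by near=> k; rewrite normr_ge0 gf.
- exact: cvg_cst.
- rewrite -(mulr0 C); apply: cvgM; first exact: cvg_cst.
  by rewrite -(@normr0 _ V); apply: cvg_norm.
Unshelve. all: by end_near. Qed.

Lemma linear_cvg (T : Type) (D : set_system T) {FD : Filter D}
    (V W : finHilbertType R) (A : {linear V -> W}) (f : T -> V) (l : V) :
  f @ D --> l -> (fun k => A (f k)) @ D --> A l.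
Proof.
have [C _ AC] := linear_bound A.
move=> fl; apply/subr_cvg0.
apply: (@bound_cvg0 _ _ _ V W C (fun k => f k - l)); last exact/subr_cvg0.
by move=> k; rewrite -linearB.
Qed.

(** By polarization, this follows from the continuity of the norm. *)
Lemma inner_cvg (T : Type) (D : set_system T) {FD : Filter D}
    (V : finHilbertType R) (f g : T -> V) (a b : V) :
  f @ D --> a -> g @ D --> b -> (fun k => '<f k, g k>) @ D --> '<a, b>.
Proof.
move=> fa gb.
have polar (u v : V) :
    '<u, v> = 2^-1 * (`|u + v| * `|u + v| - `|u| * `|u| - `|v| * `|v|).
  by rewrite -!expr2 normsqD; field.
under eq_fun do rewrite polar; rewrite polar.
apply: cvgM; first exact: cvg_cst.
by apply: cvgB; [apply: cvgB|]; apply: cvgM; apply: cvg_norm => //; exact: cvgD.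
Qed.

Lemma normsq_cvg0 (T : Type) (D : set_system T) {FD : Filter D}
    (V : finHilbertType R) (f : T -> V) :
  f @ D --> 0 -> (fun k => `|f k| ^+ 2) @ D --> 0.
Proof.
move=> f0; under eq_fun do rewrite -inner_norm.
by rewrite -(inner0r (0 : V)); exact: inner_cvg.
Qed.

(** Bolzano-Weierstrass along an ultrafilter: the finitely many coordinates stay
    in compact segments. *)
Lemma bounded_ultra_cvg (T : Type) (D : set_system T) {UD : UltraFilter D}
    (V : finHilbertType R) (f : T -> V) (M : R) :
  (forall k, `|f k| <= M) -> exists l : V, f @ D --> l.
Proof.
move=> fM; have [n [a [b vE]]] := inner_frame V.
have coord_cvg i : exists l : R, (fun k => '<a i, f k>) @ D --> l.
  pose N := `|a i| * M.
  have := @segment_compact R (- N) N; rewrite compact_ultra.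
  move=> /(_ ((fun k => '<a i, f k>) @ D)) [].
  - split; first exact: fmap_proper_filter.
    move=> G GF DG; rewrite predeqE => A; split; last exact: DG.
    move=> GA; have [//|] := in_ultra_setVsetC ((fun k => '<a i, f k>) @^-1` A) UD.
    move=> DnA; have /DG GnA : ((fun k => '<a i, f k>) @ D) (~` A) by [].
    by have [x []] := filter_ex (filterI GA GnA).
  - apply: nearW => k /=; rewrite in_itv /= -ler_norml.
    by apply: le_trans (cauchy_schwarz _ _) _; rewrite ler_wpM2l.
  - by move=> l [_ ll]; exists l.
have [l ll] := choice coord_cvg.
exists (\sum_i l i *: b i).
have -> : f = (fun k => \sum_i '<a i, f k> *: b i) by apply/funext => k.
elim: (index_enum _) => [|i r IHr].
  by rewrite big_nil; under eq_fun do rewrite big_nil; exact: cvg_cst.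
rewrite big_cons; under eq_fun do rewrite big_cons.
by apply: cvgD => //; apply: cvgZ; [exact: ll|exact: cvg_cst].
Qed.

(** With S a linear right inverse of A on its range, for w in this range
    |w|^2 = '<A (S w), w> = '<S w, As w> <= C |w| |As w|. *)
Lemma range_bound (V W : finHilbertType R) (A : {linear V -> W})
    (As : {linear W -> V}) : is_adjoint A As ->
  exists2 C, 0 <= C & forall w, range A w -> `|w| <= C * `|As w|.
Proof.
move=> adj; pose S := ((linfun A)^-1)%VF.
have [C C0 SC] := linear_bound S.
exists C => // w [v _ <-].
have ASA : A (S (A v)) = A v.
  have := @limg_lfunVK _ _ _ (linfun A) (linfun A v) (memv_img _ (memvf v)).
  by rewrite !lfunE.
have [->|w0] := eqVneq (A v) 0; first by rewrite normr0 mulr_ge0.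
rewrite -(@ler_pM2l _ `|A v|) ?normr_gt0 // -expr2 -inner_norm -{1}ASA adj.
apply: le_trans (inner_le _ _) _; rewrite mulrA ler_wpM2r // mulrC.
exact: SC.
Qed.

Lemma limg_adjoint_disjoint (V W : finHilbertType R) (A : {linear V -> W})
    (As : {linear W -> V}) : is_adjoint A As ->
  (limg (linfun As) :&: lker (linfun A))%VS = 0%VS.
Proof.
move=> adj; apply/eqP; rewrite -subv0; apply/subvP => v.
rewrite memv_cap memv_ker memv0 lfunE => /andP[/memv_imgP[w _ ->]] /eqP.
rewrite lfunE => AAs; rewrite -normr_eq0.
by rewrite -sqrf_eq0 -inner_norm -adj AAs inner0l.
Qed.

(** The range of A and the kernel of its adjoint span the space.  They are
    disjoint, as are the range of the adjoint and the kernel of A; the two resulting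
    inequalities between dimensions and the rank formula leave no room. *)
Lemma range_adjoint_ker (V W : finHilbertType R) (A : {linear V -> W})
    (As : {linear W -> V}) : is_adjoint A As ->
  forall w, exists v, As (w - A v) = 0.
Proof.
move=> adj.
have adj' : is_adjoint As A by move=> w v; rewrite innerC -adj innerC.
have full : (limg (linfun A) + lker (linfun As) == fullv)%VS.
  rewrite eqEdim subvf /= dimv_disjoint_sum; last exact: limg_adjoint_disjoint.
  have rk := limg_ker_dim (linfun A) fullv.
  have rks := limg_ker_dim (linfun As) fullv.
  have := dimvS (subvf (limg (linfun As) + lker (linfun A))%VS).
  rewrite dimv_disjoint_sum; last exact: limg_adjoint_disjoint.
  by move: rk rks; rewrite !capfv; lia.
move=> w; have : w \in (limg (linfun A) + lker (linfun As))%VS.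
  by rewrite (eqP full) memvf.
move=> /memv_addP[_ /memv_imgP[v _ ->] [n]].
rewrite memv_ker lfunE => /eqP n0 ->; exists v.
by rewrite lfunE /= [X in As X]addrC addKr.
Qed.

(** The range component in the decomposition above is the nearest point, by
    Pythagoras; the other component is killed by the adjoint. *)
Lemma metric_proj_range (V W : finHilbertType R) (A : {linear V -> W})
    (As : {linear W -> V}) : is_adjoint A As -> forall w,
  range A (metric_proj (range A) w) /\ As (metric_proj (range A) w) = As w.
Proof.
move=> adj w; have [v Awv] := range_adjoint_ker adj w.
have pyth v' : `|w - A v'| ^+ 2 = `|w - A v| ^+ 2 + `|A (v - v')| ^+ 2.
  have -> : w - A v' = (w - A v) + A (v - v') by rewrite linearB addrA subrK.
  by rewrite normsqD innerC adj Awv inner0r mulr0 addr0.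
suff -> : metric_proj (range A) w = A v.
  split; first by exists v.
  by apply/esym/eqP; rewrite -subr_eq0 -linearB Awv.
apply: xget_unique.
  split; first by exists v.
  move=> _ [v' _ <-]; rewrite -(@ler_pXn2r _ 2) ?nnegrE // (pyth v').
  by rewrite lerDl exprn_ge0.
move=> _ [[v' _ <-] /(_ (A v))]; rewrite -(@ler_pXn2r _ 2) ?nnegrE // (pyth v').
move=> /(_ (ex_intro2 _ _ v I erefl)); rewrite gerDl => le0.
apply/esym/eqP; rewrite -subr_eq0 -linearB -normr_eq0 -sqrf_eq0.
by rewrite eq_le le0 exprn_ge0.
Qed.

Lemma metric_proj_lipschitz (V W : finHilbertType R) (A : {linear V -> W})
    (As : {linear W -> V}) : is_adjoint A As ->
  exists2 C, 0 <= C & forall w w',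
    `|metric_proj (range A) w - metric_proj (range A) w'| <= C * `|As (w - w')|.
Proof.
move=> adj; have [C C0 AsC] := range_bound adj; exists C => // w w'.
have [[v _ vE] AsE] := metric_proj_range adj w.
have [[v' _ vE'] AsE'] := metric_proj_range adj w'.
rewrite linearB -AsE -AsE' -linearB; apply: AsC.
by rewrite -vE -vE'; exists (v - v') => //; rewrite linearB.
Qed.

(** Only the projection of w onto the range of A matters on the left, and its norm
    is controlled by |As w|. *)
Lemma inner_adjoint_bound (V W : finHilbertType R) (A : {linear V -> W})
    (As : {linear W -> V}) : is_adjoint A As ->
  exists2 C, 0 <= C & forall v w, `|'<v, As w>| <= C * `|A v| * `|As w|.
Proof.
move=> adj; have [C C0 AsC] := range_bound adj; exists C => // v w.
have [rw AsE] := metric_proj_range adj w.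
rewrite -AsE -adj; apply: le_trans (cauchy_schwarz _ _) _.
by rewrite (mulrC C) -mulrA ler_wpM2l //; exact: AsC.
Qed.

End LinearMaps.

(** * Real sequences with summable errors *)

Section RealSequences.
Context (R : realType).
Implicit Types (u e D : nat -> R).

Lemma nneg_summable_cvg u (M : R) : (forall k, 0 <= u k) ->
  (forall n, series u n <= M) -> cvgn (series u).
Proof.
move=> u0 uM; apply: nondecreasing_is_cvgn.
  by apply/nondecreasing_seqP => n; rewrite !seriesEnat /= big_nat_recr //= lerDl.
by exists M => _ [n _ <-].
Qed.

Lemma nneg_summable_bound u : (forall k, 0 <= u k) -> cvgn (series u) ->
  exists2 M, 0 <= M & forall n, series u n <= M.
Proof.
move=> u0 cu; exists (limn (series u)) => [|n].
  by apply: limr_ge => //; near=> n; exact: sumr_ge0.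
apply: nondecreasing_cvgn_le => //.
by apply/nondecreasing_seqP => m; rewrite !seriesEnat /= big_nat_recr //= lerDl.
Unshelve. all: by end_near. Qed.

(** Summing the recursion gives (1 - rho) sum u <= u_0 + sum e. *)
Lemma contraction_summable u e (rho : R) : 0 <= rho < 1 ->
  (forall k, 0 <= u k) -> (forall k, 0 <= e k) ->
  (forall k, u k.+1 <= rho * u k + e k) ->
  cvgn (series e) -> cvgn (series u).
Proof.
move=> /andP[rho0 rho1] u0 e0 ue ce.
have [M M0 eM] := nneg_summable_bound e0 ce.
apply: (@nneg_summable_cvg _ ((u 0%N + M) / (1 - rho))) => // n.
rewrite ler_pdivlMr ?subr_gt0 //.
have : series u n + u n <= u 0%N + rho * series u n + series e n.
  rewrite !seriesEnat /=; elim: n => [|n IHn].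
    by rewrite !big_geq // mulr0 addr0 addr0 add0r.
  rewrite !big_nat_recr //=; have := ue n; lra.
have := eM n; have := u0 n; lra.
Qed.

(** The errors are relative to the size of u, so boundedness comes first: once the
    tail of the series of e is below 1/8, an induction keeps u below
    K = 4 (u_N + 1).  The errors are then absolute and summable, so that u minus
    their partial sums is nonincreasing and bounded below, and the series of D
    converges. *)
Lemma quasi_fejer u D e : (forall k, 0 <= u k) -> (forall k, 0 <= D k) ->
  (forall k, 0 <= e k) -> cvgn (series e) ->
  (forall k, u k.+1 + D k <= u k + e k * (1 + u k + u k.+1)) ->
  [/\ cvgn u, exists M, forall k, u k <= M /\ D k <= M & D @ \oo --> 0].
Proof.
move=> u0 D0 e0 ce ueD.
have [M M0 eM] := nneg_summable_bound e0 ce.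
have [N Ne] : exists N, forall n, (N <= n)%N ->
    series e n - series e N <= 8^-1.
  have /cvgrPdist_le /(_ 16^-1) [//|N _ NE] := ce.
  exists N => n Nn; have := NE n Nn; have := NE N (leqnn N) => /=.
  by rewrite !ler_norml => /andP[? ?] /andP[? ?]; lra.
have eS n : series e n.+1 = series e n + e n.
  by rewrite !seriesEnat /= big_nat_recr.
pose K := 4 * (u N + 1).
have uN := u0 N.
(* e multiplies the unknown u_(k+1) as well, so the step first derives the crude
   bound u_(k+1) <= K from e <= 1/8. *)
have tail n : u (N + n)%N <= u N + (series e (N + n)%N - series e N) * (1 + 2 * K).
  elim: n => [|n IH]; first by rewrite addn0 subrr mul0r addr0.
  have K1 : 0 <= 1 + 2 * K by rewrite /K; lra.
  have eN8 := Ne (N + n)%N (leq_addr n N).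
  have := Ne (N + n.+1)%N (leq_addr _ _); rewrite addnS eS => eN8'.
  have e_ge0 : 0 <= e (N + n)%N by [].
  have e_le8 : e (N + n)%N <= 8^-1.
    have : series e N <= series e (N + n)%N.
      elim: (n) => [|m]; first by rewrite addn0.
      by rewrite addnS eS; have := e0 (N + m)%N; lra.
    lra.
  have u_le := ler_wpM2r K1 eN8.
  have step := ueD (N + n)%N; have := D0 (N + n)%N => D_ge0.
  have v0 := u0 (N + n)%N; have v0' := u0 (N + n).+1.
  have e_step : e (N + n)%N * (1 + u (N + n)%N + u (N + n).+1)
      <= 8^-1 * (1 + u (N + n)%N + u (N + n).+1) by rewrite ler_wpM2r //; lra.
  have u_leK : u (N + n).+1 <= K by rewrite /K in u_le IH *; lra.
  have : e (N + n)%N * (1 + u (N + n)%N + u (N + n).+1)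
      <= e (N + n)%N * (1 + 2 * K) by rewrite ler_wpM2l //; rewrite /K in u_le IH u_leK *; lra.
  lra.
pose B := \sum_(0 <= k < N) u k + K.
have uB k : u k <= B.
  have [Nk|kN] := leqP N k.
    have := tail (k - N)%N; rewrite subnKC //.
    have K1 : 0 <= 1 + 2 * K by rewrite /K; lra.
    have := ler_wpM2r K1 (Ne k Nk).
    have : 0 <= \sum_(0 <= k < N) u k by exact: sumr_ge0.
    rewrite /B /K; lra.
  rewrite /B (big_cat_nat _ (n := k)) //=; last exact: ltnW.
  rewrite [X in _ + X + _]big_ltn //.
  have : 0 <= \sum_(0 <= i < k) u i by exact: sumr_ge0.
  have : 0 <= \sum_(k.+1 <= i < N) u i by exact: sumr_ge0.
  rewrite /K; lra.
have B0 : 0 <= B := le_trans (u0 0%N) (uB 0%N).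
pose Q := 1 + 2 * B.
have stepQ k : u k.+1 + D k <= u k + e k * Q.
  apply: le_trans (ueD k) _; rewrite lerD2l ler_wpM2l // /Q.
  by have := uB k; have := uB k.+1; lra.
split; last 1 first.
- apply: cvg_series_cvg_0; apply: (@nneg_summable_cvg _ (u 0%N + M * Q)) => // n.
  have : series D n + u n <= u 0%N + series e n * Q.
    elim: n => [|n IHn]; first by rewrite !seriesEnat /= !big_geq // mul0r addr0 add0r.
    have -> : series D n.+1 = series D n + D n by rewrite !seriesEnat /= big_nat_recr.
    by rewrite eS; have := stepQ n; lra.
  have Q0 : 0 <= Q by rewrite /Q; lra.
  have := ler_wpM2r Q0 (eM n); have := u0 n; lra.
- have -> : u = (fun k => (u k - series e k * Q) + series e k * Q).
    by apply/funext => k; rewrite subrK.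
  have ceQ : cvgn (fun k => series e k * Q) by apply: is_cvgM => //; exact: is_cvg_cst.
  apply: is_cvgD => //; apply: nonincreasing_is_cvgn.
    apply/nonincreasing_seqP => k; rewrite eS.
    by have := stepQ k; have := D0 k; lra.
  exists (- (M * Q)) => _ [k _ <-].
  have Q0 : 0 <= Q by rewrite /Q; lra.
  by have := ler_wpM2r Q0 (eM k); have := u0 k; lra.
- exists (B + M * Q) => k; have Q0 : 0 <= Q by rewrite /Q; lra.
  have MQ := mulr_ge0 M0 Q0; split; first by have := uB k; lra.
  have ekM : e k <= M.
    have := eM k.+1; rewrite eS; have : 0 <= series e k by exact: sumr_ge0.
    lra.
  have := ler_wpM2r Q0 ekM; have := stepQ k; have := uB k; have := u0 k.+1; lra.
Unshelve. all: by end_near. Qed.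

Lemma sqr_bound_cvg0 (V : normedModType R) (f : nat -> V) D (a : R) : 0 < a ->
  (forall k, a * `|f k| ^+ 2 <= D k) -> D @ \oo --> 0 -> f @ \oo --> 0.
Proof.
move=> a0 fD D_cvg; apply/cvgr0Pnorm_lt => t t0.
have at0 : 0 < a * t ^+ 2 by rewrite mulr_gt0 // exprn_gt0.
have near_D : \forall k \near \oo, `|D k| < a * t ^+ 2 by exact: cvgr0_norm_lt.
apply: filterS near_D => k Dk; rewrite -(@ltr_pXn2r _ 2) ?nnegrE ?(ltW t0) //.
rewrite -(ltr_pM2l a0); apply: le_lt_trans (fD k) _.
exact: le_lt_trans (ler_norm _) Dk.
Qed.

Lemma le_1Dsqr (t : R) : t <= 1 + t ^+ 2.
Proof. by have := sqr_ge0 (t - 1); rewrite sqrrB1; nra. Qed.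

End RealSequences.

(** * Subdifferentials of convex functions *)

Section Subdifferential.
Context (R : realType) (V : finHilbertType R).
Implicit Types f : V -> \bar R.

(** The value mu = 0 is plain convexity, so that both cases of the theorem are
    treated at once. *)
Definition convex_modulus (mu : R) f : Prop :=
  forall (u v : V) (t : R), 0 <= t <= 1 ->
    (f (t *: u + (1 - t) *: v)%R <=
     t%:E * f u + (1 - t)%:E * f v
     - (mu / 2 * t * (1 - t) * `|u - v| ^+ 2)%:E)%E.

Lemma convex_modulus0 f : convex_efun f -> convex_modulus 0 f.
Proof. by move=> cf u v t t01; rewrite !mul0r sube0; exact: cf. Qed.

Lemma le0_of_small (a C : R) :
  (forall t, 0 < t <= 1 -> a <= t * C) -> a <= 0.
Proof.
move=> aC; rewrite leNgt; apply/negP => a0.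
have aC1 : a <= C by have := aC 1; rewrite mul1r ltr01 lexx; exact.
have C0 : 0 < C := lt_le_trans a0 aC1.
have /aC : 0 < a / (2 * C) <= 1.
  rewrite divr_gt0 ?mulr_gt0 //= ler_pdivrMr ?mulr_gt0 //; lra.
have -> : a / (2 * C) * C = a / 2 by field; rewrite gt_eqF.
lra.
Qed.

Lemma subdiff_fin f u g : Defs.proper f -> subdiff f u g ->
  exists r : R, f u = r%:E.
Proof.
move=> [fNy [v fv]] /(_ v); have := fNy v; have := fNy u; move: fv.
case: (f v) => // s _; case: (f u) => // r; by exists r.
Qed.

(** The half of the sum rule that is needed: g plays the gradient of q at u.  The
    subgradient inequality is tested at the point u + t (v - u), the convexity of f
    is used on the segment, and t tends to 0. *)
Lemma subdiff_perturbed f (mu : R) (q : V -> R) u d g (C : R) :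
  Defs.proper f -> convex_modulus mu f ->
  (forall v, q v <= q u + '<g, v - u> + C * `|v - u| ^+ 2) ->
  subdiff (fun v => f v + (q v)%:E)%E u d ->
  forall v, (f u + ('<d - g, v - u> + mu / 2 * `|v - u| ^+ 2)%:E <= f v)%E.
Proof.
move=> pf cf qC sub v.
have [r fu] : exists r : R, f u = r%:E.
  have [fNy [w fw]] := pf; have := sub w; have := fNy w; have := fNy u; move: fw.
  by case: (f w) => // s _; case: (f u) => // r; exists r.
have [fNy _] := pf.
case fv : (f v) => [s| |]; [|by rewrite leey|by have := fNy v; rewrite fv].
rewrite fu -EFinD lee_fin -subr_le0.
apply: (@le0_of_small _ (`|v - u| ^+ 2 * (C + mu / 2))) => t /andP[t0 t1].
have t01 : 0 <= t <= 1 by rewrite (ltW t0).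
have := cf v u t t01; have := sub (t *: v + (1 - t) *: u).
have -> : t *: v + (1 - t) *: u - u = t *: (v - u).
  by rewrite scalerBr scalerBl scale1r addrA addrAC addrK.
rewrite fu fv; case fw : (f _) => [w| |].
- rewrite !lee_fin => sub_t conv_t.
  have := qC (t *: v + (1 - t) *: u).
  have -> : t *: v + (1 - t) *: u - u = t *: (v - u).
    by rewrite scalerBr scalerBl scale1r addrA addrAC addrK.
  rewrite normsqZ !innerZr in sub_t *; rewrite innerDl innerNl.
  move: sub_t conv_t; move: ('<d, _>) ('<g, _>) (`|v - u| ^+ 2) => a b N.
  move: (q _) (q u) => q1 q2 sub_t conv_t q_t.
  rewrite -(ler_pM2l t0); nra.
- by move=> _; rewrite -!EFinM -!EFinD leye_eq.
- by have := fNy (t *: v + (1 - t) *: u); rewrite fw.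
Qed.

Lemma subdiff_strong f (mu : R) u g : Defs.proper f -> convex_modulus mu f ->
  subdiff f u g ->
  forall v, (f u + ('<g, v - u> + mu / 2 * `|v - u| ^+ 2)%:E <= f v)%E.
Proof.
move=> pf cf sub v; rewrite -[g]subr0.
apply: (@subdiff_perturbed _ _ (fun=> 0) _ _ _ 0) => //.
  by move=> w; rewrite inner0l mul0r !addr0.
by move=> w; rewrite !adde0; exact: sub.
Qed.

Lemma subdiff_monotone f (mu : R) u v g h : Defs.proper f -> convex_modulus mu f ->
  subdiff f u g -> subdiff f v h ->
  mu * `|u - v| ^+ 2 <= '<g - h, u - v>.
Proof.
move=> pf cf sg sh.
have := subdiff_strong pf cf sg v; have := subdiff_strong pf cf sh u.
have [r ->] := subdiff_fin pf sg; have [s ->] := subdiff_fin pf sh.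
rewrite !lee_fin -[v - u]opprB normrN !innerNr innerDl innerNl.
lra.
Qed.

(** By semicontinuity, if f v were too small then f (u k) would stay above
    f v - '<g0, v - u0> by a fixed amount, against the subgradient inequality at
    u k. *)
Lemma subdiff_closed (T : Type) (D : set_system T) {PD : ProperFilter D}
    f (u g : T -> V) (u0 g0 : V) :
  lower_semicontinuous f -> Defs.proper f ->
  u @ D --> u0 -> g @ D --> g0 -> (forall k, subdiff f (u k) (g k)) ->
  subdiff f u0 g0.
Proof.
move=> lsc [fNy _] uu0 gg0 sub v.
case fv : (f v) => [s| |]; [|by rewrite leey|by have := fNy v; rewrite fv].
rewrite leNgt; apply/negP => lt_s.
set a := '<g0, v - u0> in lt_s.
have [e e0 ea] : exists2 e, 0 < e & ((s - a + e)%:E < f u0)%E.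
  move: lt_s; case fu : (f u0) => [r| |].
  - rewrite -EFinD lte_fin => sra; exists ((r + a - s) / 2); first by rewrite divr_gt0 // subr_gt0.
    by rewrite lte_fin; lra.
  - by move=> _; exists 1 => //; rewrite ltry.
  - by have := fNy u0; rewrite fu.
have [W W0 fW] := lsc _ _ ea.
have : (fun k => '<g k, v - u k>) @ D --> a.
  by apply: inner_cvg => //; apply: cvgB => //; exact: cvg_cst.
move=> /cvgrPdist_lt /(_ _ e0) near_a.
have near_W : \forall k \near D, W (u k) by exact: uu0.
have [k [/= ka kW]] := filter_ex (filterI near_a near_W).
have := sub k v; have := fW _ kW; rewrite fv; case: (f (u k)) => [w| |] //.
by rewrite lte_fin lee_fin; move: ka; rewrite ltr_norml => /andP[_]; lra.
Qed.

End Subdifferential.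

(** * Optimality conditions of the two subproblems *)

Section OptimalityConditions.
Context (R : realType) (X Y Z : finHilbertType R).
Context (p : Y -> \bar R) (F : {linear X -> Y}) (G : {linear X -> Z}).
Context (Fs : {linear Y -> X}) (Gs : {linear Z -> X}) (b : Z) (c : X).
Context (sigma : R).
Context (adjF : is_adjoint F Fs) (adjG : is_adjoint G Gs).

Definition residual (y : Y) (z : Z) : X := Fs y + Gs z - c.

(** The finite part of the augmented Lagrangian. *)
Definition penalty (x : X) (y : Y) (z : Z) : R :=
  - '<b, z> + '<x, residual y z> + sigma / 2 * `|residual y z| ^+ 2.

Lemma aug_lagrangianE x y z :
  aug_lagrangian p Fs Gs b c sigma y z x = (p y + (penalty x y z)%:E)%E.
Proof. by rewrite /aug_lagrangian /penalty !EFinD EFinN !addeA. Qed.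

Lemma penalty_shift_y x y z h :
  penalty x (y + h) z = penalty x y z
    + '<F (x + sigma *: residual y z), h> + sigma / 2 * `|Fs h| ^+ 2.
Proof.
rewrite /penalty adjF.
have -> : residual (y + h) z = residual y z + Fs h.
  by rewrite /residual linearD -!addrA; congr (_ + _); rewrite addrC !addrA.
by rewrite normsqD !innerE; field.
Qed.

Lemma penalty_shift_z x y z h :
  penalty x y (z + h) = penalty x y z
    + '<G (x + sigma *: residual y z) - b, h> + sigma / 2 * `|Gs h| ^+ 2.
Proof.
rewrite /penalty innerDl innerNl adjG.
have -> : residual y (z + h) = residual y z + Gs h.
  by rewrite /residual linearD addrA (addrAC _ (Gs h) (- c)).
by rewrite normsqD !innerE; field.
Qed.

Lemma y_step_subdiff x y z d : Defs.proper p -> convex_efun p -> 0 <= sigma ->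
  subdiff (fun v => aug_lagrangian p Fs Gs b c sigma v z x) y d ->
  subdiff p y (d - F (x + sigma *: residual y z)).
Proof.
move=> pp cp s0 sub v.
have [C C0 FsC] := linear_bound Fs.
have := @subdiff_perturbed _ _ p 0 (fun v => penalty x v z) y d
  (F (x + sigma *: residual y z)) (sigma / 2 * C ^+ 2) pp (convex_modulus0 cp).
move=> /(_ _ _ v); rewrite !mul0r addr0; apply.
- move=> w; rewrite -{1}[w](subrK y).
  have -> : w - y + y = y + (w - y) by rewrite addrC.
  rewrite penalty_shift_y lerD2l -[leRHS]mulrA ler_wpM2l ?divr_ge0 //.
  by rewrite -exprMn ler_pXn2r ?nnegrE ?mulr_ge0.
- by move=> w; have := sub w; rewrite !aug_lagrangianE.
Qed.

Lemma y_step_finite x y z d : Defs.proper p ->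
  subdiff (fun v => aug_lagrangian p Fs Gs b c sigma v z x) y d ->
  p y \is a fin_num.
Proof.
move=> [pNy [v pv]] /(_ v); rewrite !aug_lagrangianE.
have := pNy v; have := pNy y; move: pv.
by case: (p v) => // s _; case: (p y).
Qed.

Lemma argmin_subdiff (V : finHilbertType R) (f : V -> \bar R) u :
  argmin f u -> subdiff f u 0.
Proof. by move=> fu v; rewrite inner0l adde0; exact: fu. Qed.

Lemma z_step_argmin x y z : 0 <= sigma -> p y \is a fin_num ->
  argmin (fun w => aug_lagrangian p Fs Gs b c sigma y w x) z ->
  G (x + sigma *: residual y z) - b = 0.
Proof.
move=> s0; case py : (p y) => [r| |] // _ am.
set g := G _ - b.
have am_shift h : 0 <= '<g, h> + sigma / 2 * `|Gs h| ^+ 2.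
  have := am (z + h); rewrite !aug_lagrangianE py penalty_shift_z lee_fin -/g.
  lra.
apply/eqP; rewrite -normr_eq0 -sqrf_eq0 eq_le exprn_ge0 // andbT.
apply: (@le0_of_small _ _ (sigma / 2 * `|Gs g| ^+ 2)) => t /andP[t0 _].
have := am_shift (- t *: g).
rewrite innerZr [Gs _]linearZ /= normsqZ inner_norm => h; rewrite -(ler_pM2l t0).
nra.
Qed.

(** The directional derivatives of the augmented Lagrangian in z are read off its
    exact quadratic expansion. *)
Lemma z_step_gradient x y z g : p y \is a fin_num ->
  is_gradient (fun w => fine (aug_lagrangian p Fs Gs b c sigma y w x)) z g ->
  g = G (x + sigma *: residual y z) - b.
Proof.
case py : (p y) => [r| |] // _ [df dfE]; apply: inner_inj => h.
rewrite -dfE -deriveE // /derive; apply: cvg_lim => //.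
set g0 := G _ - b; pose A w : R := fine (aug_lagrangian p Fs Gs b c sigma y w x).
have quot (t : R) : t != 0 ->
    t^-1 *: (A (t *: h + z) - A z) = '<g0, h> + t * (sigma / 2 * `|Gs h| ^+ 2).
  move=> t0; rewrite /A !aug_lagrangianE py -!EFinD /= [t *: h + z]addrC.
  rewrite penalty_shift_z innerZr [Gs _]linearZ /= normsqZ -/g0.
  by rewrite /GRing.scale /=; field.
have lim0 : '<g0, h> + t * (sigma / 2 * `|Gs h| ^+ 2) @[t --> (0 : R)^'] --> '<g0, h>.
  rewrite -[X in _ --> X]addr0 -[X in _ --> _ + X](mul0r (sigma / 2 * `|Gs h| ^+ 2)).
  apply: cvgD; first exact: cvg_cst.
  apply: cvgM; last exact: cvg_cst.
  by apply: cvg_within.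
apply: cvg_trans lim0; apply: near_eq_cvg.
near=> t; rewrite -quot //.
by near: t; exact: nbhs_dnbhs_neq.
Unshelve. all: by end_near. Qed.

(** What the convergence proof uses of one iteration, common to the classic
    (eps = 0) and the inexact method: the optimality conditions up to eps k. *)
Definition approximate_steps (tau : R) (eps : nat -> R)
    (x : nat -> X) (y : nat -> Y) (z : nat -> Z) : Prop :=
  forall k,
  [/\ exists2 d, `|d| <= eps k &
        subdiff p (y k.+1) (d - F (x k + sigma *: residual (y k.+1) (z k))),
      `|G (x k + sigma *: residual (y k.+1) (z k.+1)) - b| <= eps k &
      x k.+1 = x k + (tau * sigma) *: residual (y k.+1) (z k.+1)].

Lemma inexact_admm_steps tau eps x y z :
  closed_proper_convex p -> 0 <= sigma ->
  inexact_admm p Fs Gs b c sigma tau eps x y z ->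
  approximate_steps tau eps x y z.
Proof.
move=> [_ pp cp] s0 [_ steps] k; have [[d dsub deps] [g ggrad geps] xE] := steps k.
split=> //; first by exists d => //; exact: y_step_subdiff.
by rewrite -(z_step_gradient (y_step_finite pp dsub) ggrad).
Qed.

Lemma classic_admm_steps tau x y z :
  closed_proper_convex p -> 0 <= sigma ->
  classic_admm p Fs Gs b c sigma tau x y z ->
  approximate_steps tau (fun=> 0) x y z.
Proof.
move=> [_ pp cp] s0 [_ steps] k; have [/argmin_subdiff ysub zmin xE] := steps k.
split=> //; first by exists 0; rewrite ?normr0 //; exact: y_step_subdiff.
by rewrite (z_step_argmin s0 (y_step_finite pp ysub) zmin) normr0.
Qed.

Lemma kkt_subdiff x y z : kkt p F G Fs Gs b c (x, y, z) <->
  [/\ subdiff p y (- F x), G x = b & Fs y + Gs z = c].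
Proof.
split=> [[[g gsub /eqP]]|[sub Gx FG]]; last first.
  by split=> //; [exists (- F x) => //; rewrite addNr | rewrite Gx subrr].
by rewrite addr_eq0 => /eqP <- /eqP; rewrite subr_eq0 => /eqP.
Qed.

End OptimalityConditions.

(** * Energy estimate and convergence *)

Section Convergence.
Context (R : realType) (X Y Z : finHilbertType R).
Context (p : Y -> \bar R) (F : {linear X -> Y}) (G : {linear X -> Z}).
Context (Fs : {linear Y -> X}) (Gs : {linear Z -> X}) (b : Z) (c : X).
Context (sigma tau mu : R) (eps : nat -> R).
Context (x : nat -> X) (y : nat -> Y) (z : nat -> Z).
Context (closed_p : lower_semicontinuous p) (proper_p : Defs.proper p).
Context (modulus_p : convex_modulus mu p) (mu0 : 0 <= mu).
Context (adjF : is_adjoint F Fs) (adjG : is_adjoint G Gs).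
Context (sigma0 : 0 < sigma) (tau02 : 0 < tau < 2).
Context (eps0 : forall k, 0 <= eps k) (sum_eps : cvgn (series eps)).
Context (steps : approximate_steps p F G Fs Gs b c sigma tau eps x y z).
Context (control : (exists2 C, 0 <= C & forall v, `|v| <= C * `|Fs v|) \/ 0 < mu).

Let r k := residual Fs Gs c (y k) (z k).

(* Every error of the k-th iteration is bounded by a multiple of eta k. *)
Let eta k := eps k + `|G (x k) - b|.

Let eta0 k : 0 <= eta k.
Proof. by rewrite addr_ge0. Qed.

Let xS k : x k.+1 = x k + (tau * sigma) *: r k.+1.
Proof. by have [] := steps k. Qed.

Let Gr k : sigma *: G (r k.+1) =
  (G (x k + sigma *: r k.+1) - b) - (G (x k) - b).
Proof.
move: (r k.+1) => r'; rewrite linearD linearZ /= opprB addrA subrK.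
by rewrite addrAC subrr add0r.
Qed.

(** The quantity G (x k + sigma *: r k.+1) - b is the error of the z-step, and
    x k.+1 is an affine combination of x k and x k + sigma *: r k.+1, with weights
    1 - tau and tau. *)
Lemma gap_step k :
  `|G (x k.+1) - b| <= `|1 - tau| * `|G (x k) - b| + tau * eps k.
Proof.
have [_ Geps _] := steps k; have /andP[t0 _] := tau02.
have -> : G (x k.+1) - b = (1 - tau) *: (G (x k) - b)
    + tau *: (G (x k + sigma *: r k.+1) - b).
  rewrite xS (linearD G (x k)) linearZ /= -scalerA Gr scalerBr.
  rewrite scalerBl scale1r [LHS]addrAC -[RHS]addrA; congr (_ + _).
  by rewrite addrC.
apply: le_trans (ler_normD _ _) _; rewrite !normrZ (gtr0_norm t0).
by rewrite lerD2l ler_wpM2l // ltW.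
Qed.

Lemma eta_summable : cvgn (series eta).
Proof.
have /andP[t0 t2] := tau02.
have gap : cvgn (series (fun k => `|G (x k) - b|)).
  apply: (@contraction_summable _ _ (fun k => tau * eps k) `|1 - tau|) => //.
  - rewrite normr_ge0 /= ltr_norml; lra.
  - by move=> k; rewrite mulr_ge0 // ltW.
  - exact: gap_step.
  - have [M _ epsM] := nneg_summable_bound eps0 sum_eps.
    apply: (@nneg_summable_cvg _ _ (tau * M)) => [k|n].
      by rewrite mulr_ge0 // ltW.
    by rewrite seriesEnat /= -mulr_sumr ler_wpM2l ?(ltW t0) //; exact: epsM.
have -> : series eta = series eps + series (fun k => `|G (x k) - b|).
  by apply/funext => n; rewrite seriesEnat /eta /= big_split.
exact: is_cvgD.
Qed.

Section BasePoint.
Context (xb : X) (yb : Y) (zb : Z).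
Context (kkt_b : kkt p F G Fs Gs b c (xb, yb, zb)).

Let w k := Gs (z k - zb).

Definition energy k :=
  `|x k - xb| ^+ 2 / (2 * (tau * sigma)) + sigma / 2 * `|w k| ^+ 2.

(** Strong convexity provides mu |y - yb|^2; one half is kept here, the other absorbs
    the error of the y-step. *)
Definition dissipation k :=
  sigma * (1 - tau / 2) * `|r k.+1| ^+ 2 + sigma / 2 * `|w k.+1 - w k| ^+ 2
  + mu / 2 * `|y k.+1 - yb| ^+ 2.

Let FsE k : Fs (y k - yb) = r k - w k.
Proof.
have /kkt_subdiff[_ _ FGb] := kkt_b.
by rewrite /r /residual /w -FGb !linearB /= (opprD (Fs yb)) addrACA addrK opprK subrK.
Qed.

(** Pure algebra: xe, r', w', w0 stand for the multiplier error, the new residual,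
    and the new and old values of G* (z - zb); r' - w' is the image of the y-error
    by F*. *)
Lemma energy_identity (a : R) (xe r' w' w0 : X) :
  a <= - '<xe + sigma *: (r' - w' + w0), r' - w'> ->
  `|xe + (tau * sigma) *: r'| ^+ 2 / (2 * (tau * sigma)) + sigma / 2 * `|w'| ^+ 2
  + sigma * (1 - tau / 2) * `|r'| ^+ 2 + sigma / 2 * `|w' - w0| ^+ 2 + a
  <= `|xe| ^+ 2 / (2 * (tau * sigma)) + sigma / 2 * `|w0| ^+ 2
     + '<xe + sigma *: r', w'> - sigma * '<r', w0 - w'>.
Proof.
have /andP[t0 t2] := tau02; move=> aE.
have -> : `|xe + (tau * sigma) *: r'| ^+ 2 / (2 * (tau * sigma)) =
    `|xe| ^+ 2 / (2 * (tau * sigma)) + '<xe, r'> + tau * sigma / 2 * `|r'| ^+ 2.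
  by rewrite normsqD normsqZ innerZr; field; rewrite !gt_eqF.
move: aE; rewrite (normsqD w' (- w0)) normrN !innerE !inner_norm.
rewrite (innerC w' r') (innerC w0 r') (innerC w0 w').
lra.
Qed.

(** The hypothesis of the algebraic identity is the monotonicity of the
    subdifferential of p between y k.+1 and yb, with d the error of the y-step. *)
Lemma energy_step k : exists2 d, `|d| <= eps k &
  energy k.+1 + dissipation k + mu / 2 * `|y k.+1 - yb| ^+ 2 <=
  energy k + '<d, y k.+1 - yb> + '<x k - xb + sigma *: r k.+1, w k.+1>
  - sigma * '<r k.+1, w k - w k.+1>.
Proof.
have /kkt_subdiff[subb Gxb FGb] := kkt_b.
have [[d deps dsub] _ _] := steps k; exists d => //.
rewrite /residual in dsub.
have := subdiff_monotone proper_p modulus_p dsub subb.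
have -> : Fs (y k.+1) + Gs (z k) - c = r k.+1 - w k.+1 + w k.
  by rewrite -FsE /w (linearB Fs) (linearB Gs) -FGb opprD addrACA.
set s := sigma *: _.
have -> : d - F (x k + s) - - F xb = d - F (x k - xb + s).
  by rewrite (addrAC (x k) (- xb)) (linearB F (x k + s)) opprB opprK addrA addrAC.
move=> mono; rewrite innerDl innerNl adjF FsE {}/s in mono.
have := @energy_identity (mu * `|y k.+1 - yb| ^+ 2 - '<d, y k.+1 - yb>)
  (x k - xb) (r k.+1) (w k.+1) (w k).
have -> : x k - xb + (tau * sigma) *: r k.+1 = x k.+1 - xb by rewrite xS addrAC.
rewrite /energy /dissipation => ident.
have {}ident := ident _; have := ident ltac:(lra).
lra.
Qed.

Lemma energy_ge0 k : 0 <= energy k.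
Proof.
have /andP[t0 _] := tau02.
by rewrite addr_ge0 ?mulr_ge0 ?invr_ge0 ?mulr_ge0 // ltW.
Qed.

Lemma dissipation_ge0 k : 0 <= dissipation k.
Proof.
have /andP[_ t2] := tau02.
by rewrite !addr_ge0 // !mulr_ge0 ?exprn_ge0 ?invr_ge0 ?(ltW sigma0) //; lra.
Qed.

Lemma energy_ge_w k : sigma / 2 * `|w k| ^+ 2 <= energy k.
Proof.
have /andP[t0 _] := tau02.
by rewrite lerDr ?mulr_ge0 ?invr_ge0 ?mulr_ge0 // ltW.
Qed.

Lemma energy_ge_x k : (2 * (tau * sigma))^-1 * `|x k - xb| ^+ 2 <= energy k.
Proof. by rewrite mulrC lerDl mulr_ge0 ?exprn_ge0 ?divr_ge0 // ltW. Qed.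

Let Kw := 1 + 2 / sigma.
Let Kx := 1 + 2 * (tau * sigma).

Lemma norm_w_le k : `|w k| <= Kw * (1 + energy k).
Proof.
apply: le_trans (le_1Dsqr _) _.
have -> : `|w k| ^+ 2 = 2 / sigma * (sigma / 2 * `|w k| ^+ 2).
  by field; rewrite gt_eqF.
have q0 : 0 <= 2 / sigma by rewrite divr_ge0 // ltW.
have := ler_wpM2l q0 (energy_ge_w k); have := energy_ge0 k; rewrite /Kw; nra.
Qed.

Lemma norm_x_le k : `|x k - xb| <= Kx * (1 + energy k).
Proof.
have /andP[t0 _] := tau02.
apply: le_trans (le_1Dsqr _) _.
have -> : `|x k - xb| ^+ 2 =
    2 * (tau * sigma) * ((2 * (tau * sigma))^-1 * `|x k - xb| ^+ 2).
  by field; rewrite !gt_eqF.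
have q0 : 0 <= 2 * (tau * sigma) by rewrite !mulr_ge0 // ltW.
have := ler_wpM2l q0 (energy_ge_x k); have := energy_ge0 k; rewrite /Kx; nra.
Qed.

(* All first-order quantities at steps k and k.+1 are bounded by multiples of T k. *)
Let T k := 1 + energy k + energy k.+1.

Let T_ge1 k : 1 <= T k.
Proof. by have := energy_ge0 k; have := energy_ge0 k.+1; rewrite /T; lra. Qed.

Let Kw0 : 0 <= Kw. Proof. by rewrite addr_ge0 // divr_ge0 // ltW. Qed.

Let Kx0 : 0 <= Kx.
Proof. by have /andP[t0 _] := tau02; rewrite addr_ge0 // !mulr_ge0 // ltW. Qed.

Let w_le_T k : `|w k| <= Kw * T k.
Proof.
apply: le_trans (norm_w_le k) _; rewrite ler_wpM2l // lerDl; exact: energy_ge0.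
Qed.

Let wS_le_T k : `|w k.+1| <= Kw * T k.
Proof.
apply: le_trans (norm_w_le k.+1) _; rewrite ler_wpM2l //.
by have := energy_ge0 k; rewrite /T; lra.
Qed.

Let r_le_T k : `|r k.+1| <= 2 * Kx / (tau * sigma) * T k.
Proof.
have /andP[t0 _] := tau02.
have ts0 : 0 < tau * sigma by rewrite mulr_gt0.
rewrite mulrAC ler_pdivlMr // mulrC -[X in X * _]gtr0_norm // -normrZ.
have -> : (tau * sigma) *: r k.+1 = (x k.+1 - xb) - (x k - xb).
  by rewrite xS opprB addrA subrK addrAC subrr add0r.
apply: le_trans (ler_normB _ _) _.
have := norm_x_le k; have := norm_x_le k.+1.
have := energy_ge0 k; have := energy_ge0 k.+1; have := Kx0; rewrite /T; nra.
Qed.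

(** If F is surjective, y - yb is controlled by its image by F*, which is r - w;
    otherwise strong convexity puts its square into the dissipation. *)
Lemma primal_norm_le : exists2 C, 0 <= C &
  forall k, `|y k.+1 - yb| <= C * (T k + dissipation k).
Proof.
case: control => [[C C0 FsC]|mu_gt0].
- exists (C * (2 * Kx / (tau * sigma) + Kw)) => [|k].
    have /andP[t0 _] := tau02.
    by rewrite mulr_ge0 // addr_ge0 // divr_ge0 ?mulr_ge0 // ltW.
  apply: le_trans (FsC _) _; rewrite FsE -mulrA ler_wpM2l //.
  apply: le_trans (ler_normB _ _) _.
  have rT := r_le_T k; have wT := wS_le_T k; have D0 := dissipation_ge0 k.
  have rw_le : `|r k.+1| + `|w k.+1| <= (2 * Kx / (tau * sigma) + Kw) * T k by lra.
  apply: le_trans rw_le _; apply: ler_wpM2l; last by rewrite lerDl.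
  have := T_ge1 k; have := le_trans (normr_ge0 _) wT; have := le_trans (normr_ge0 _) rT.
  by move=> a1 a2 a3; apply: addr_ge0 => //; rewrite -(@pmulr_lge0 _ (T k)) //; lra.
- exists (1 + 2 / mu) => [|k]; first by rewrite addr_ge0 // divr_ge0 // ltW.
  apply: le_trans (le_1Dsqr _) _.
  have -> : `|y k.+1 - yb| ^+ 2 = 2 / mu * (mu / 2 * `|y k.+1 - yb| ^+ 2).
    by field; rewrite gt_eqF.
  have q0 : 0 <= 2 / mu by rewrite divr_ge0 // ltW.
  have D_ge : mu / 2 * `|y k.+1 - yb| ^+ 2 <= dissipation k.
    have /andP[_ t2] := tau02.
    by rewrite lerDr addr_ge0 // !mulr_ge0 ?exprn_ge0 ?invr_ge0 ?(ltW sigma0) //; lra.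
  have := ler_wpM2l q0 D_ge; have := T_ge1 k; have := dissipation_ge0 k.
  move: q0; move: (2 / mu) => q; nra.
Qed.

(** In the strongly convex case this is Young's inequality, whose quadratic part is
    absorbed by the energy inequality. *)
Lemma primal_error : exists2 C, 0 <= C & forall k,
  eps k * `|y k.+1 - yb| <= C * eta k * T k + mu / 2 * `|y k.+1 - yb| ^+ 2.
Proof.
have eps_eta k : eps k <= eta k by rewrite lerDl.
case: control => [[C C0 FsC]|mu_gt0].
- exists (C * (2 * Kx / (tau * sigma) + Kw)) => [|k].
    have /andP[t0 _] := tau02.
    by rewrite mulr_ge0 // addr_ge0 // divr_ge0 ?mulr_ge0 // ltW.
  have yT : `|y k.+1 - yb| <= C * ((2 * Kx / (tau * sigma) + Kw) * T k).
    apply: le_trans (FsC _) _; rewrite FsE ler_wpM2l //.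
    apply: le_trans (ler_normB _ _) _.
    by have := r_le_T k; have := wS_le_T k; lra.
  have : eps k * `|y k.+1 - yb| <= eta k * (C * ((2 * Kx / (tau * sigma) + Kw) * T k)).
    exact: ler_pM.
  have : 0 <= mu / 2 * `|y k.+1 - yb| ^+ 2 by rewrite mulr_ge0 // divr_ge0.
  lra.
- have [M M0 epsM] := nneg_summable_bound eps0 sum_eps.
  exists (M / (2 * mu)) => [|k]; first by rewrite divr_ge0 // mulr_ge0 // ltW.
  have ekM : eps k <= M.
    have := epsM k.+1; rewrite seriesEnat /= big_nat_recr //=.
    have : 0 <= \sum_(0 <= i < k) eps i by exact: sumr_ge0.
    lra.
  have young : eps k * `|y k.+1 - yb|
      <= eps k ^+ 2 / (2 * mu) + mu / 2 * `|y k.+1 - yb| ^+ 2.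
    have : 0 <= (eps k - mu * `|y k.+1 - yb|) ^+ 2 / (2 * mu).
      by rewrite divr_ge0 ?sqr_ge0 // mulr_ge0 // ltW.
    suff -> : (eps k - mu * `|y k.+1 - yb|) ^+ 2 / (2 * mu) =
      eps k ^+ 2 / (2 * mu) + mu / 2 * `|y k.+1 - yb| ^+ 2 - eps k * `|y k.+1 - yb|.
      lra.
    by field; rewrite gt_eqF.
  apply: le_trans young _; rewrite lerD2r.
  have -> : M / (2 * mu) * eta k * T k = (M * (eta k * T k)) / (2 * mu).
    by field; rewrite gt_eqF.
  rewrite ler_wpM2r ?invr_ge0 ?mulr_ge0 // ?(ltW mu_gt0) // expr2.
  apply: ler_pM => //; apply: le_trans (eps_eta k) _.
  by rewrite ler_peMr.
Qed.

(** The cross terms pair a vector v with an element of the range of G*.  They are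
    bounded through G v, which is the error of the z-step in T2, and the difference of
    this error and of the violation G (x k) - b in T3. *)
Lemma energy_quasi_decrease : exists2 C, 0 <= C & forall k,
  energy k.+1 + dissipation k <=
  energy k + C * eta k * (1 + energy k + energy k.+1).
Proof.
have [C1 C10 yC] := primal_error.
have [C2 C20 GC] := inner_adjoint_bound adjG.
exists (C1 + 3 * (C2 * Kw)) => [|k].
  by rewrite addr_ge0 // !mulr_ge0.
have [d deps step] := energy_step k.
have [_ Geps _] := steps k.
have [_ Gxb _] := (kkt_subdiff _ _ _ _ _ _ _ _ _ _).1 kkt_b.
have T1 : '<d, y k.+1 - yb> <= eps k * `|y k.+1 - yb|.
  by apply: le_trans (inner_le _ _) _; rewrite ler_wpM2r.
have T2 : '<x k - xb + sigma *: r k.+1, w k.+1> <= C2 * Kw * (eta k * T k).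
  apply: le_trans (ler_norm _) _; apply: le_trans (GC _ (z k.+1 - zb)) _.
  have -> : x k - xb + sigma *: r k.+1 = (x k + sigma *: r k.+1) - xb.
    by rewrite addrAC.
  rewrite (linearB G) Gxb -!mulrA ler_wpM2l // mulrCA.
  by apply: ler_pM; rewrite ?wS_le_T //; apply: le_trans Geps _; rewrite lerDl.
have T3 : - (sigma * '<r k.+1, w k - w k.+1>) <= 2 * (C2 * Kw * (eta k * T k)).
  have wE : w k.+1 - w k = Gs (z k.+1 - z k).
    by rewrite /w -linearB opprB addrA subrK.
  have -> : - (sigma * '<r k.+1, w k - w k.+1>) =
      '<sigma *: r k.+1, w k.+1 - w k>.
    by rewrite innerZl -[w k - _]opprB innerNr mulrN opprK.
  rewrite wE; apply: le_trans (ler_norm _) _; apply: le_trans (GC _ _) _.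
  rewrite -wE.
  have -> : G (sigma *: r k.+1) = sigma *: G (r k.+1) by rewrite linearZ.
  have w2 : `|w k.+1 - w k| <= 2 * (Kw * T k).
    by apply: le_trans (ler_normB _ _) _; have := w_le_T k; have := wS_le_T k; lra.
  have g_eta : `|sigma *: G (r k.+1)| <= eta k.
    by rewrite Gr; apply: le_trans (ler_normB _ _) _; rewrite lerD2r.
  apply: (@le_trans _ _ (C2 * eta k * (2 * (Kw * T k)))); last by lra.
  by apply: ler_pM => //; rewrite ?mulr_ge0 // ler_wpM2l.
have := yC k; rewrite -/(T k); lra.
Qed.

Lemma energy_limit : [/\ cvgn energy,
  exists M, forall k, energy k <= M /\ dissipation k <= M &
  dissipation @ \oo --> 0].
Proof.
have [C C0 decr] := energy_quasi_decrease.
apply: (@quasi_fejer _ _ _ (fun k => C * eta k)) => //.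
- exact: energy_ge0.
- exact: dissipation_ge0.
- by move=> k; rewrite mulr_ge0.
- have [M _ etaM] := nneg_summable_bound eta0 eta_summable.
  apply: (@nneg_summable_cvg _ _ (C * M)) => [k|n]; first by rewrite mulr_ge0.
  by rewrite seriesEnat /= -mulr_sumr ler_wpM2l //; exact: etaM.
Qed.

Lemma residual_cvg0 : (fun k => r k.+1) @ \oo --> 0.
Proof.
have [_ _ D0] := energy_limit; have /andP[t0 t2] := tau02.
apply: (@sqr_bound_cvg0 _ _ _ _ (sigma * (1 - tau / 2))) D0.
  by rewrite mulr_gt0 //; lra.
move=> k; rewrite /dissipation -addrA lerDl addr_ge0 // mulr_ge0 //.
  by rewrite divr_ge0 // ltW.
by rewrite divr_ge0.
Qed.

Lemma increment_cvg0 : (fun k => Gs (z k.+1) - Gs (z k)) @ \oo --> 0.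
Proof.
have [_ _ D0] := energy_limit; have /andP[t0 t2] := tau02.
apply: (@sqr_bound_cvg0 _ _ _ _ (sigma / 2)) D0; first by rewrite divr_gt0.
move=> k; have -> : Gs (z k.+1) - Gs (z k) = w k.+1 - w k.
  by rewrite /w -!linearB opprB addrA subrK.
rewrite /dissipation addrAC lerDr addr_ge0 // mulr_ge0 ?exprn_ge0 ?divr_ge0 //.
by rewrite mulr_ge0 ?(ltW sigma0) //; lra.
Qed.

Lemma iterates_bounded : exists M, forall k,
  [/\ `|x k.+1 - xb| <= M, `|y k.+1 - yb| <= M & `|Gs (z k.+1 - zb)| <= M].
Proof.
have [_ [M EM] _] := energy_limit; have [C C0 yC] := primal_norm_le.
have M0 : 0 <= M := le_trans (energy_ge0 0%N) (EM 0%N).1.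
pose K := Kx * (1 + M) + Kw * (1 + M) + C * (1 + 3 * M).
have M1 : 0 <= 1 + M by rewrite addr_ge0.
have M3 : 0 <= 1 + 3 * M by rewrite addr_ge0 // mulr_ge0.
have KxM := mulr_ge0 Kx0 M1; have KwM := mulr_ge0 Kw0 M1; have CM := mulr_ge0 C0 M3.
exists K => k; have [Ek Dk] := EM k; have [Ek1 _] := EM k.+1; split.
- apply: le_trans (norm_x_le _) _.
  have : Kx * (1 + energy k.+1) <= Kx * (1 + M) by rewrite ler_wpM2l // lerD2l.
  rewrite /K; lra.
- apply: le_trans (yC k) _.
  have : C * (T k + dissipation k) <= C * (1 + 3 * M).
    by rewrite ler_wpM2l // /T; lra.
  rewrite /K; lra.
- apply: le_trans (norm_w_le _) _.
  have : Kw * (1 + energy k.+1) <= Kw * (1 + M) by rewrite ler_wpM2l // lerD2l.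
  rewrite /K; lra.
Qed.

(** Surjectivity of F gives the convergence of y from that of r - w; strong
    convexity gives it from the dissipation. *)
Lemma energy_cvg0 : energy @ \oo --> 0 ->
  [/\ x @ \oo --> xb, y @ \oo --> yb & (fun k => Gs (z k - zb)) @ \oo --> 0].
Proof.
have /andP[t0 t2] := tau02; move=> E0.
have w0 : (fun k => Gs (z k - zb)) @ \oo --> 0.
  by apply: (@sqr_bound_cvg0 _ _ _ _ (sigma / 2)) energy_ge_w E0; rewrite divr_gt0.
split=> //.
  apply/subr_cvg0.
  apply: (@sqr_bound_cvg0 _ _ _ _ (2 * (tau * sigma))^-1) energy_ge_x E0.
  by rewrite invr_gt0 !mulr_gt0.
rewrite -cvg_shiftS; apply/subr_cvg0.
case: control => [[C C0 FsC]|mu_gt0].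
- apply: (@bound_cvg0 _ _ _ _ X _ C (fun k => r k.+1 - w k.+1)).
    by move=> k; rewrite -FsE; exact: FsC.
  rewrite -[X in _ --> X]subr0; apply: cvgB; first exact: residual_cvg0.
  by have := w0; rewrite -(cvg_shiftS (fun k => Gs (z k - zb))).
- have [_ _ D0] := energy_limit.
  apply: (@sqr_bound_cvg0 _ _ _ _ (mu / 2)) D0; first by rewrite divr_gt0.
  move=> k; rewrite /dissipation lerDr addr_ge0 // !mulr_ge0 ?exprn_ge0 ?invr_ge0 ?(ltW sigma0) //; lra.
Qed.

End BasePoint.

Lemma gap_cvg0 : (fun k => G (x k) - b) @ \oo --> 0.
Proof.
have eta_cvg : eta @ \oo --> 0 := cvg_series_cvg_0 eta_summable.
apply: (@bound_cvg0 _ _ _ _ _ _ 1 eta) eta_cvg => k.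
by rewrite mul1r ger0_norm // lerDr.
Qed.

Lemma subgradients : exists g : nat -> Y,
  (forall k, subdiff p (y k.+1) (g k)) /\
  (fun k => g k + F (x k + sigma *: (Fs (y k.+1) + Gs (z k) - c))) @ \oo --> 0.
Proof.
have /choice[g gP] : forall k, exists g, subdiff p (y k.+1) g /\
    `|g + F (x k + sigma *: (Fs (y k.+1) + Gs (z k) - c))| <= eps k.
  move=> k; have [[d deps dsub] _ _] := steps k.
  by exists (d - F (x k + sigma *: (Fs (y k.+1) + Gs (z k) - c))); rewrite subrK.
exists g; split; first by move=> k; have [] := gP k.
have eps_cvg : eps @ \oo --> 0 := cvg_series_cvg_0 sum_eps.
apply: (@bound_cvg0 _ _ _ _ _ _ 1 eps) eps_cvg => k.
by rewrite mul1r (ger0_norm (eps0 k)); have [] := gP k.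
Qed.

(** The component of z in the kernel of G* is not controlled, so the limit is taken
    for the projections of the z k onto the range of G, which have the same images by
    G*.  All limits use the index k.+1, at which the subgradients live; x k and z k
    differ from their successors by terms that tend to 0. *)
Lemma ultra_limit_kkt : kkt p F G Fs Gs b c !=set0 ->
  exists U : set_system nat, exists w : X * Y * Z,
  [/\ ProperFilter U, \oo `<=` U, kkt p F G Fs Gs b c w &
  [/\ (fun k => x k.+1) @ U --> w.1.1, (fun k => y k.+1) @ U --> w.1.2 &
      (fun k => Gs (z k.+1)) @ U --> Gs w.2]].
Proof.
move=> [[[xb yb] zb] kb].
have [U [UU ooU]] := ultraFilterLemma eventually_filter.
have [M xyzM] := iterates_bounded kb.
have lift (V : normedModType R) (f : nat -> V) (l : V) :
    f @ \oo --> l -> f @ U --> l.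
  by move=> fl A /fl; exact: ooU.
have [C C0 projC] := metric_proj_lipschitz adjG.
pose P := @metric_proj R Z (range G).
have PE v : Gs (P v) = Gs v by have [] := metric_proj_range adjG v.
have [lx lxU] := @bounded_ultra_cvg _ _ _ UU X (fun k => x k.+1 - xb) M
  (fun k => let: And3 h _ _ := xyzM k in h).
have [ly lyU] := @bounded_ultra_cvg _ _ _ UU Y (fun k => y k.+1 - yb) M
  (fun k => let: And3 _ h _ := xyzM k in h).
have [lz lzU] : exists l : Z, (fun k => P (z k.+1) - P zb) @ U --> l.
  apply: (@bounded_ultra_cvg _ _ _ UU Z _ (C * M)) => k.
  by apply: le_trans (projC _ _) _; rewrite ler_wpM2l //; have [] := xyzM k.
pose xi := lx + xb; pose yi := ly + yb; pose zi := lz + P zb.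
have xU : (fun k => x k.+1) @ U --> xi.
  under eq_fun do rewrite -(subrK xb (x _)).
  by apply: cvgD => //; exact: cvg_cst.
have yU : (fun k => y k.+1) @ U --> yi.
  under eq_fun do rewrite -(subrK yb (y _)).
  by apply: cvgD => //; exact: cvg_cst.
have zU : (fun k => Gs (z k.+1)) @ U --> Gs zi.
  have -> : (fun k => Gs (z k.+1)) = (fun k => Gs (P (z k.+1) - P zb + P zb)).
    by apply/funext => k; rewrite subrK PE.
  by apply: linear_cvg; apply: cvgD => //; exact: cvg_cst.
exists U, (xi, yi, zi); split; [exact: ultra_proper|exact: ooU| |by []].
apply/kkt_subdiff; split.
- have [g [gsub g0]] := subgradients.
  apply: (subdiff_closed closed_p proper_p yU _ gsub).
  pose h k := x k + sigma *: (Fs (y k.+1) + Gs (z k) - c).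
  have hE k : h k = x k.+1 + ((sigma - tau * sigma) *: r k.+1
      - sigma *: (Gs (z k.+1) - Gs (z k))).
    rewrite /h; have -> : Fs (y k.+1) + Gs (z k) - c = r k.+1 - (Gs (z k.+1) - Gs (z k)).
      rewrite /r /residual opprB [RHS]addrCA (addrAC _ (- c) (- _)) addrK.
      by rewrite addrA (addrC (Fs _)).
    rewrite xS scalerBr scalerBl -!addrA; congr (_ + _).
    by rewrite [RHS]addrCA; congr (_ + _); rewrite addrA subrr add0r.
  have hU : h @ U --> xi.
    have scale_cvg0 (a : R) (f : nat -> X) :
        f @ \oo --> 0 -> (fun k => a *: f k) @ U --> 0.
      move=> f0; rewrite -(scaler0 _ a); apply: cvgZ; first exact: cvg_cst.
      exact: lift.
    have := cvgD xU (cvgB (scale_cvg0 (sigma - tau * sigma) _ (residual_cvg0 kb))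
      (scale_cvg0 sigma _ (increment_cvg0 kb))).
    rewrite (funext hE) subr0 addr0; exact.
  have -> : g = (fun k => (g k + F (h k)) - F (h k)).
    by apply/funext => k; rewrite addrK.
  rewrite -(sub0r (F xi)); apply: cvgB; first exact: lift.
  exact: linear_cvg.
- have Gx : (fun k => G (x k.+1) - b) @ U --> G xi - b.
    by apply: cvgB; [exact: linear_cvg|exact: cvg_cst].
  have G0 : (fun k => G (x k.+1) - b) @ U --> 0.
    apply: lift; have := gap_cvg0.
    by rewrite -(cvg_shiftS (fun k => G (x k) - b)).
  by apply/eqP; rewrite -subr_eq0; apply/eqP; exact: cvg_unique Gx G0.
- have rU : (fun k => r k.+1) @ U --> Fs yi + Gs zi - c.
    apply: cvgB; last exact: cvg_cst.
    by apply: cvgD => //; exact: linear_cvg.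
  have r0 := lift _ _ _ (residual_cvg0 kb).
  by apply/eqP; rewrite -subr_eq0; apply/eqP; exact: cvg_unique rU r0.
Qed.

(** The energy relative to the limit along the ultrafilter converges, and its limit
    is read along the ultrafilter. *)
Lemma steps_converge : kkt p F G Fs Gs b c !=set0 ->
  exists w : X * Y * Z, [/\ kkt p F G Fs Gs b c w,
    x @ \oo --> w.1.1, y @ \oo --> w.1.2 &
    (fun k => Gs (z k - w.2)) @ \oo --> 0].
Proof.
move=> /ultra_limit_kkt[U [[[xi yi] zi] [UU ooU kw [/= xU yU zU]]]].
exists (xi, yi, zi); suff: energy xi zi @ \oo --> 0 by move=> /(energy_cvg0 kw)[].
have [cE _ _] := energy_limit kw.
have E0 : (fun k => energy xi zi k.+1) @ U --> 0.
  have x0 : (fun k => x k.+1 - xi) @ U --> 0 by exact/subr_cvg0.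
  have w0 : (fun k => Gs (z k.+1 - zi)) @ U --> 0.
    by under eq_fun do rewrite linearB; exact/subr_cvg0.
  have x_part : (fun k => `|x k.+1 - xi| ^+ 2 / (2 * (tau * sigma))) @ U --> 0.
    rewrite -(mul0r (2 * (tau * sigma))^-1).
    by apply: cvgM; [exact: (normsq_cvg0 x0)|exact: cvg_cst].
  have w_part : (fun k => sigma / 2 * `|Gs (z k.+1 - zi)| ^+ 2) @ U --> 0.
    rewrite -(mulr0 (sigma / 2)).
    by apply: cvgM; [exact: cvg_cst|exact: (normsq_cvg0 w0)].
  by have := cvgD x_part w_part; rewrite addr0; exact.
have El : (fun k => energy xi zi k.+1) @ U --> limn (energy xi zi).
  have : (fun k => energy xi zi k.+1) @ \oo --> limn (energy xi zi).
    by rewrite (cvg_shiftS (energy xi zi)).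
  by move=> El A /El; exact: ooU.
by rewrite -(cvg_unique _ El E0).
Qed.

End Convergence.

(** * Assembling the theorem *)

Lemma surjective_adjoint_bound (R : realType) (X Y : finHilbertType R)
    (F : {linear X -> Y}) (Fs : {linear Y -> X}) : is_adjoint F Fs ->
  set_surj [set: X] [set: Y] F ->
  exists2 C, 0 <= C & forall v, `|v| <= C * `|Fs v|.
Proof.
move=> adj surjF; have [C C0 FsC] := range_bound adj; exists C => // v.
by apply: FsC; have [u _ <-] := surjF v I; exists u.
Qed.

Lemma metric_proj_surj (R : realType) (X Z : finHilbertType R)
    (G : {linear X -> Z}) : set_surj [set: X] [set: Z] G ->
  forall w, metric_proj (range G) w = w.
Proof.
move=> surjG w; apply: xget_unique.
  split; first by have [v _ <-] := surjG w I; exists v.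
  by move=> v _; rewrite subrr normr0.
move=> v [_ /(_ w)]; rewrite subrr normr0 => vw.
have /vw : range G w by have [u _ <-] := surjG w I; exists u.
by rewrite normr_le0 subr_eq0 => /eqP.
Qed.

Theorem mainTheorem5 (R : realType) (X Y Z : finHilbertType R)
    (p : Y -> \bar R) (F : {linear X -> Y}) (G : {linear X -> Z})
    (Fs : {linear Y -> X}) (Gs : {linear Z -> X}) (b : Z) (c : X)
    (sigma tau : R) (x : nat -> X) (y : nat -> Y) (z : nat -> Z) :
  closed_proper_convex p ->
  is_adjoint F Fs ->
  is_adjoint G Gs ->
  kkt p F G Fs Gs b c !=set0 ->
  0 < sigma ->
  0 < tau < 2 ->
  (classic_admm p Fs Gs b c sigma tau x y z \/
   exists eps : nat -> R,
     [/\ forall k, 0 <= eps k,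
         cvgn (series eps) &
         inexact_admm p Fs Gs b c sigma tau eps x y z]) ->
  (set_surj [set: X] [set: Y] F \/ strongly_convex p) ->
  (exists2 w : X * Y * Z, kkt p F G Fs Gs b c w &
     (x k, y k, metric_proj (range G) (z k)) @[k --> \oo] --> w) /\
  (set_surj [set: X] [set: Z] G ->
   exists2 w : X * Y * Z, kkt p F G Fs Gs b c w &
     (x k, y k, z k) @[k --> \oo] --> w).
Proof.
move=> [lsc_p proper_p convex_p] adjF adjG kkt0 sigma0 tau02 admm surj_or_strong.
have closed_p : closed_proper_convex p by [].
have [eps [eps0 sum_eps steps]] : exists eps : nat -> R, [/\ forall k, 0 <= eps k,
    cvgn (series eps) & approximate_steps p F G Fs Gs b c sigma tau eps x y z].
  case: admm => [classic|[eps [eps0 sum_eps inexact]]]; last first.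
    by exists eps; split=> //; exact: inexact_admm_steps (ltW sigma0) inexact.
  exists (fun=> 0); split=> //; last exact: classic_admm_steps (ltW sigma0) classic.
  have -> : series (fun=> 0 : R) = fun=> 0.
    by apply/funext => n; rewrite seriesEnat /= big1.
  exact: is_cvg_cst.
have [mu [mu0 modulus_p control]] : exists mu : R, [/\ 0 <= mu,
    convex_modulus mu p &
    (exists2 C, 0 <= C & forall v, `|v| <= C * `|Fs v|) \/ 0 < mu].
  case: surj_or_strong => [surjF|[mu mu_gt0 strong_p]].
    exists 0; split=> //; first exact: convex_modulus0.
    by left; exact: surjective_adjoint_bound surjF.
  by exists mu; split; [exact: ltW| |right].
have [[[xi yi] zi] [/kkt_subdiff[subi Gxi FGi] /= xcv ycv zcv]] :=
  steps_converge lsc_p proper_p modulus_p mu0 adjF adjG sigma0 tau02 eps0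
    sum_eps steps control kkt0.
have [C C0 projC] := metric_proj_lipschitz adjG.
pose P := @metric_proj R Z (range G).
have proj_main : exists2 w : X * Y * Z, kkt p F G Fs Gs b c w &
    (x k, y k, P (z k)) @[k --> \oo] --> w.
  exists (xi, yi, P zi).
    apply/kkt_subdiff; split=> //.
    by have [_ ->] := metric_proj_range adjG zi.
  have zP : (fun k => P (z k)) @ \oo --> P zi.
    apply/subr_cvg0; apply: (@bound_cvg0 _ _ _ _ X _ C) zcv => k.
    exact: projC.
  exact: (cvg_pair (cvg_pair xcv ycv) zP).
split=> // surjG; have [w kw w_cvg] := proj_main; exists w => //.
by move: w_cvg; under eq_fun do rewrite /P metric_proj_surj //.
Qed.
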